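(* Let $n,k\in\mathbb{N}$ with $k\ge 2$. Suppose consecutive letters are drawn, independently and uniformly at random, from $\{1,2,\ldots,n\}$ until a streak of length $k$ is obtained. Then the expected number $E(n,k)$ of letters drawn is given by $$E(n,k)=\frac{1}{\displaystyle\sum_{r=0}^n\psi_{k,r}\binom{n}{r}n^{-r}}=\frac{k}{\displaystyle\sum_{s=1}^{k-1}\left(1-\omega_k^{-s}\right)\left(1+\frac{\omega_k^s}{n}\right)^n}.$$
   Context: $\mathbb{N}=\{1,2,3,\ldots\}$ and $\omega_k=e^{2\pi i/k}$. For $k\in\mathbb{N}$ with $k\ge 2$ and $r\in\mathbb{Z}$, $\psi_{k,r}=1$ if $r\equiv 0\pmod k$, $\psi_{k,r}=-1$ if $r\equiv 1\pmod k$, and $\psi_{k,r}=0$ otherwise. A streak of length $k$ is a strictly increasing word of length $k$; it is obtained the first time that the last $k$ consecutive letters drawn form a strictly increasing word, and the number of letters drawn counts all letters up to and including that draw. *)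

(* Defs.v *)
From HB Require Import structures.
From mathcomp Require Import all_boot all_order all_algebra.
From mathcomp Require Import all_classical all_reals all_analysis.
From mathcomp Require Export complex.

Set Implicit Arguments.
Unset Strict Implicit.
Unset Printing Implicit Defensive.

Import Order.TTheory GRing.Theory Num.Theory.

Local Open Scope classical_set_scope.
Local Open Scope ring_scope.
Local Open Scope complex_scope.

Definition psi (k : nat) (r : int) : int :=
  if (r == 0 %[mod k])%Z then 1
  else if (r == 1 %[mod k])%Z then -1
  else 0.

(* [omega R k] is e^(2 pi i / k), written with Euler's formula. *)
Definition omega (R : realType) (k : nat) : R[i] :=
  cos (2 * pi / k%:R) +i* sin (2 * pi / k%:R).

(* The infinite word [w] is indexed from 0: after [m] draws the letters drawn
   are [w 0], ..., [w (m - 1)], and the last [k] of them have the indices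
   [m - k], ..., [m - 1]. *)
Definition streak_at (k : nat) (w : nat -> nat) (m : nat) : bool :=
  (k <= m)%N && sorted ltn [seq w i | i <- iota (m - k) k].

(* The infimum is a minimum if a streak ever occurs in [w]; otherwise it is the
   infimum of the empty set, which is [+oo]. *)
Definition letters_drawn (R : realType) (k : nat) (w : nat -> nat) : \bar R :=
  ereal_inf [set m%:R%:E | m in [set m : nat | streak_at k w m]].

Definition mutually_independent (d d' : measure_display)
    (T : measurableType d) (T' : measurableType d') (R : realType)
    (P : probability T R) (I : choiceType) (X : I -> {RV P >-> T'}) : Prop :=
  forall (s : seq I) (B : I -> set T'),
    uniq s -> (forall i, measurable (B i)) ->
    P (\bigcap_(i in [set` s]) (X i @^-1` B i)) =
      (\prod_(i <- s) P (X i @^-1` B i))%E.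

Definition uniform_letter (d : measure_display) (T : measurableType d)
    (R : realType) (P : probability T R) (n : nat) (Y : {RV P >-> nat}) : Prop :=
  forall a : nat, (1 <= a <= n)%N -> P (Y @^-1` [set a]) = (n%:R^-1)%:E.

(* An [\bar R]-valued expectation: the library's ['E_P[_]] only takes real-valued
   functions, whereas the number of letters drawn may be [+oo]. *)
Definition expected_letters (d : measure_display) (T : measurableType d)
    (R : realType) (P : probability T R) (k : nat) (X : nat -> {RV P >-> nat}) :
    \bar R :=
  (\int[P]_t letters_drawn R k (fun i => X i t))%E.

Definition psi_sum (R : realType) (n k : nat) : R :=
  \sum_(0 <= r < n.+1) (psi k r%:Z)%:~R * 'C(n, r)%:R * n%:R ^- r.

Definition omega_sum (R : realType) (n k : nat) : R[i] :=
  \sum_(1 <= s < k) (1 - omega R k ^- s) * (1 + omega R k ^+ s / n%:R) ^+ n.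

(* Main.v *)
Require Import Defs.
From mathcomp Require Import all_boot all_order all_algebra.
From mathcomp Require Import all_classical all_reals all_analysis.
From mathcomp Require Import zify ring lra.

(** Let [q m] be the probability that no streak of length [k] occurs among the
    first [m] letters. More than [m] letters are drawn exactly in this event, so
    the expected number of letters is the sum of all the [q m]
    ([expected_letters_series]).

    Consider the ways to split a word of length [m > 0] into a streak-free first
    part and an increasing last part of length [r], and weight them by
    [psi k r]. For each word the weights add up to zero
    ([streak_cancellation]): such a splitting is within the last maximal
    increasing run of the word and leaves less than [k] letters of the run in the
    first part, so that, if there are any splittings, [r] ranges over [k]
    consecutive integers, or over [0, ..., r0] with [0 < r0 < k]. There are ['C(n, r)] increasing words of
    length [r], so averaging over all words gives, with
    [c r = psi k r * 'C(n, r) * n ^- r],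

      [\sum_(r <= m) c r * q (m - r) = 0] for [m > 0], and [c 0 * q 0 = 1]

    ([free_words_recurrence]). In terms of generating functions, the one of [q]
    is the inverse of the one of [c]; at the point [1] this says that the sum of
    [q] is the inverse of [psi_sum]. Evaluation at [1] is justified in
    [renewal_sum] by the boundedness of [q] alone, and the same argument shows
    that the sum of [q] is infinite when [psi_sum] is zero.

    The second formula follows from the first, as the roots of unity filter
    shows that [omega_sum] is the real number [k * psi_sum]
    ([omega_sumE]). *)

Set Implicit Arguments.
Unset Strict Implicit.
Unset Printing Implicit Defensive.

Import Order.TTheory GRing.Theory Num.Theory numFieldNormedType.Exports.

Local Open Scope classical_set_scope.
Local Open Scope ring_scope.

(** * Streaks in a fixed word *)

Definition increasing_on (w : nat -> nat) (a b : nat) : bool :=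
  sorted ltn [seq w i | i <- iota a (b - a)].

(** For an infinite word [w], these are the outcomes for which more than [m]
    letters get drawn. *)
Definition streak_free (k : nat) (w : nat -> nat) (m : nat) : bool :=
  all (fun j => ~~ streak_at k w j) (iota 0 m.+1).

Lemma increasing_onP w a b :
  reflect (forall i, (a <= i)%N -> (i.+1 < b)%N -> (w i < w i.+1)%N)
          (increasing_on w a b).
Proof.
rewrite /increasing_on; apply: (iffP (sortedP 0%N)) => h i.
  move=> ai ib; have := h (i - a)%N; rewrite size_map size_iota.
  rewrite !(nth_map 0%N) ?size_iota ?nth_iota; try lia.
  by rewrite addnS subnKC //; apply; lia.
rewrite size_map size_iota => ib.
rewrite !(nth_map 0%N) ?size_iota ?nth_iota; try lia.
by rewrite addnS; apply: h; lia.
Qed.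

Lemma streak_atE k w m :
  streak_at k w m = (k <= m)%N && increasing_on w (m - k) m.
Proof.
by rewrite /streak_at /increasing_on; case: leqP => //= km; rewrite subKn.
Qed.

Lemma streak_freeP k w m :
  reflect (forall j, (j <= m)%N -> ~~ streak_at k w j) (streak_free k w m).
Proof.
apply: (iffP allP) => h j.
  by move=> jm; apply: h; rewrite mem_iota.
by rewrite mem_iota add0n ltnS => /h.
Qed.

Lemma increasing_onW w a a' b :
  (a <= a')%N -> increasing_on w a b -> increasing_on w a' b.
Proof.
by move=> aa' /increasing_onP h; apply/increasing_onP => i a'i; apply: h; lia.
Qed.

(** [psi k] is the discrete derivative of the indicator of the multiples of
    [k], so its sums over intervals telescope. *)
Lemma psiS k r : (2 <= k)%N -> psi k r.+1 = (k %| r.+1)%N%:Z - (k %| r)%N%:Z.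
Proof.
move=> k2; rewrite /psi.
have -> : (r.+1%:Z == 0 %[mod k])%Z = (k %| r.+1)%N.
  by rewrite modz_nat mod0z /dvdn.
have -> : (r.+1%:Z == 1 %[mod k])%Z = (k %| r)%N.
  by rewrite !modz_nat eqz_nat -[r.+1]addn1 -{2}[1%N]add0n eqn_modDr mod0n.
case: (boolP (k %| r.+1)%N) => h1; case: (boolP (k %| r)%N) => h2 //.
by move: h1; rewrite -addn1 dvdn_addr // dvdn1; lia.
Qed.

Lemma psi0 k : psi k 0 = 1.
Proof. by rewrite /psi eqxx. Qed.

Lemma sum_psi k m : (2 <= k)%N ->
  \sum_(0 <= r < m.+1) psi k r%:Z = (k %| m)%N%:Z.
Proof.
move=> k2; elim: m => [|m IH]; first by rewrite big_nat1 psi0 dvdn0.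
by rewrite big_nat_recr //= IH psiS // addrCA subrr addr0.
Qed.

(** The index ranges over the last [k] integers up to [m]. Such a window
    contains as many multiples of [k] as successors of multiples of [k], also
    when [m < k] cuts it off at [0]: then it contains [0] and [1]. *)
Lemma sum_psi_window k m : (2 <= k)%N -> (0 < m)%N ->
  \sum_(0 <= r < m.+1 | (m < r + k)%N) psi k r%:Z = 0.
Proof.
move=> k2 m0; case: (ltnP m k) => mk.
  rewrite (eq_bigl xpredT) => [|r]; last by lia.
  by rewrite sum_psi // gtnNdvd.
rewrite (@big_cat_nat _ _ _ (m - k).+1) //=; last by lia.
rewrite big_nat_cond big_pred0 ?add0r => [|r]; last by lia.
rewrite big_nat_cond (eq_bigl (fun r => (m - k).+1 <= r < m.+1)%N) => [|r]; last by lia.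
have := sum_psi m k2; rewrite (@big_cat_nat _ _ _ (m - k).+1) //=; last by lia.
rewrite sum_psi // dvdn_subl // -big_nat => h.
apply: (addrI (k %| m)%N%:Z); rewrite addr0; exact: h.
Qed.

(** A streak ending after [D] cannot straddle the descent just before [D], so it
    lies inside the run that starts at [D]. *)
Lemma streak_free_in_run k w m D j : (2 <= k)%N ->
  increasing_on w D m -> (0 < D -> w D <= w D.-1)%N -> (D <= j <= m)%N ->
  streak_free k w j = streak_free k w D && (j - D < k)%N.
Proof.
move=> k2 /increasing_onP run stop /andP[Dj jm].
apply/streak_freeP/andP => [free|[/streak_freeP free jDk] i ij].
  split; first by apply/streak_freeP => i iD; apply: free; lia.
  rewrite ltnNge; apply/negP => kjD; move: (free j (leqnn _)).
  rewrite streak_atE => /negP; apply; apply/andP; split; first by lia.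
  by apply/increasing_onP => i ? ?; apply: run; lia.
have [iD|Di] := leqP i D; first exact: free.
rewrite streak_atE; apply/negP => /andP[ki /increasing_onP inc].
have D0 : (0 < D)%N by lia.
have : (w D.-1 < w D)%N by rewrite -{2}(prednK D0); apply: inc; lia.
by move: (stop D0); lia.
Qed.

(** Let the last maximal increasing run start at [D]. Splitting the word inside
    this run leaves an increasing last part, and the first part is streak free
    exactly when the word is so up to [D] and less than [k] letters of the run
    stay in the first part. So if any length [r] of the last part contributes,
    then those that do are the last [k] natural numbers up to [m - D]. *)
Lemma streak_cancellation k w m : (2 <= k)%N -> (0 < m)%N ->
  \sum_(0 <= r < m.+1)
     psi k r%:Z * (streak_free k w (m - r) && increasing_on w (m - r) m)%:Z = 0.
Proof.
move=> k2 m0.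
(* D is where the last maximal increasing run starts *)
have exD : exists a, increasing_on w a m.
  by exists m.-1; apply/increasing_onP => i; lia.
pose D := ex_minn exD.
have [runD minD] : increasing_on w D m /\
    forall a, increasing_on w a m -> (D <= a)%N.
  by rewrite /D; case: ex_minnP => D' ? ?; split.
have Dm : (D < m)%N.
  by have := minD m.-1; rewrite -ltnS prednK //; apply; apply/increasing_onP=> i; lia.
have stop : (0 < D -> w D <= w D.-1)%N.
  move=> D0; rewrite leqNgt; apply/negP => lt.
  have : increasing_on w D.-1 m.
    apply/increasing_onP => i; rewrite leq_eqVlt => /orP[/eqP <-|].
      by rewrite prednK.
    by move=> Di im; move/increasing_onP: runD; apply; lia.
  by move/minD; lia.
transitivity (\sum_(0 <= r < m.+1)
    (streak_free k w D)%:Z *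
    (if (r < (m - D).+1) && (m - D < r + k) then psi k r%:Z else 0)%N).
  apply: eq_big_nat => r /andP[_ rm].
  have -> : increasing_on w (m - r) m = (D <= m - r)%N.
    apply/idP/idP => [/minD //|h]; exact: increasing_onW runD.
  have [rD|rD] := leqP r (m - D); last first.
    by rewrite ifF; [rewrite (_ : (D <= m - r)%N = false) ?andbF ?mulr0 //|]; lia.
  rewrite (_ : (D <= m - r)%N); last by lia.
  rewrite (streak_free_in_run k2 runD stop) ?andbT; last by lia.
  rewrite (_ : (m - r - D < k)%N = (m - D < r + k)%N); last by lia.
  rewrite ltnS rD; case: streak_free; case: (m - D < r + k)%N;
  by rewrite /= ?mulr1 ?mulr0 ?mul1r ?mul0r.
rewrite -big_distrr /=; apply/eqP; rewrite mulf_eq0; apply/orP; right; apply/eqP.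
rewrite -big_mkcond /=.
have mD : (0 < m - D)%N by lia.
rewrite -[RHS](sum_psi_window k2 mD).
rewrite [LHS](@big_cat_nat _ _ _ (m - D).+1) //=; last by lia.
rewrite [X in _ + X]big_nat_cond [X in _ + X]big_pred0 ?addr0 => [|r]; last by lia.
by rewrite big_nat_cond [RHS]big_nat_cond; apply: eq_bigl => r; lia.
Qed.

(** * Counting streak-free words *)

(** The shift by one accounts for alphabets starting at [1] while ['I_n] starts
    at [0]. *)
Definition letters (n : nat) (w : seq 'I_n) : seq nat :=
  [seq (val i).+1 | i <- w].

Definition count_words (n m : nat) (p : pred (seq nat)) : nat :=
  #|[set w : m.-tuple 'I_n | p (letters w)]%SET|.

(** Counting form of the independence of the two blocks of a word. *)
Lemma count_words_cat n a b (p q : pred (seq nat)) :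
  count_words n (a + b) (fun s => p (take a s) && q (drop a s)) =
  (count_words n a p * count_words n b q)%N.
Proof.
rewrite /count_words -cardsX.
pose glue (uv : a.-tuple 'I_n * b.-tuple 'I_n) := cat_tuple uv.1 uv.2.
rewrite -(@card_imset _ _ glue) => [|[u v] [u' v'] /(congr1 val) /= /eqP]; last first.
  by rewrite eqseq_cat ?size_tuple // => /andP[/eqP /val_inj -> /eqP /val_inj ->].
apply: eq_card => w; rewrite inE; apply/idP/imsetP => [/andP[pw qw]|].
  have su : size (take a w) == a by rewrite size_takel // size_tuple leq_addr.
  have sv : size (drop a w) == b by rewrite size_drop size_tuple addKn.
  exists (Tuple su, Tuple sv); last by apply: val_inj; rewrite /= cat_take_drop.
  by rewrite !inE /= /letters map_take map_drop pw.
case=> -[u v]; rewrite !inE /= => /andP[pu qv] ->.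
rewrite /letters map_cat take_size_cat ?size_map ?size_tuple //.
by rewrite drop_size_cat ?size_map ?size_tuple // pu.
Qed.

Lemma eq_count_words n m (p q : pred (seq nat)) :
  (forall s, size s = m -> p s = q s) -> count_words n m p = count_words n m q.
Proof.
by move=> pq; apply: eq_card => w; rewrite !inE pq // size_map size_tuple.
Qed.

Lemma count_words_sorted n m : count_words n m (sorted ltn) = 'C(n, m).
Proof.
rewrite -card_ltn_sorted_tuples; apply: eq_card => w; rewrite !inE.
by rewrite !sorted_map.
Qed.

Lemma count_wordsT n m : count_words n m xpredT = (n ^ m)%N.
Proof. by rewrite /count_words cardsT card_tuple card_ord. Qed.

Lemma streak_at_ext k w w' m :
  (forall i, (i < m)%N -> w i = w' i) -> streak_at k w m = streak_at k w' m.
Proof.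
move=> ww'; rewrite /streak_at; case: leqP => //= km; congr sorted.
by apply/eq_in_map => i; rewrite mem_iota => ?; apply: ww'; lia.
Qed.

Lemma streak_free_ext k w w' m :
  (forall i, (i < m)%N -> w i = w' i) ->
  streak_free k w m = streak_free k w' m.
Proof.
move=> ww'; apply: eq_in_all => j; rewrite mem_iota => jm; congr (~~ _).
by apply: streak_at_ext => i ?; apply: ww'; lia.
Qed.

Definition free_words (n k m : nat) : nat :=
  count_words n m (fun s => streak_free k (nth 0%N s) m).

(** Summing the cancellation identity over all words of length [m]: for each
    [r] the two parts are chosen independently, and the increasing words of
    length [r] correspond to the [r]-element sets of letters. *)
Lemma free_words_recurrence n k m : (2 <= k)%N -> (0 < m)%N ->
  \sum_(0 <= r < m.+1) psi k r%:Z * ('C(n, r) * free_words n k (m - r))%N%:Z = 0.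
Proof.
move=> k2 m0.
pose T (w : m.-tuple 'I_n) r :=
  streak_free k (nth 0%N (letters w)) (m - r) &&
  increasing_on (nth 0%N (letters w)) (m - r) m.
transitivity (\sum_(0 <= r < m.+1) \sum_(w : m.-tuple 'I_n)
    psi k r%:Z * (T w r)%:Z); last first.
  by rewrite exchange_big big1 // => w _; exact: streak_cancellation.
apply: eq_big_nat => r /andP[_ rm]; rewrite -big_distrr /=; congr (_ * _).
rewrite mulnC -count_words_sorted /free_words -count_words_cat subnK //.
rewrite /count_words -sum1_card (big_morph Posz PoszD (erefl _)) big_mkcond /=.
apply: eq_bigr => w _; rewrite inE /T /increasing_on.
have sw : size (letters w) = m by rewrite size_map size_tuple.
rewrite map_nth_iota ?sw //.
rewrite [take (m - (m - r)) _]take_oversize ?size_drop ?sw //.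
rewrite (@streak_free_ext _ (nth 0%N (take _ _)) (nth 0%N (letters w))) => [|i im].
  by case: ifP.
by rewrite nth_take.
Qed.

(** * Sums of convolution inverses *)

Section Renewal.
Context (R : realType) (n : nat) (c q : nat -> R).
Context (q01 : forall m, 0 <= q m <= 1).
Context (c_supp : forall r, (n < r)%N -> c r = 0).
Context (cq0 : c 0%N * q 0%N = 1).
Context (cqS : forall m, (0 < m)%N -> \sum_(0 <= r < m.+1) c r * q (m - r)%N = 0).

Let Q := series q.

(** The convolution relations, added up over the first [N + n + 1] indices. The
    arguments of [Q] are written as shifts of [N] by numbers independent of
    [N], in order to let [N] tend to infinity with [r] fixed. *)
Lemma renewal_partial_sums N :
  \sum_(0 <= r < n.+1) c r * Q (N + (n.+1 - r))%N = 1.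
Proof.
have conv M : \sum_(0 <= r < M.+1) c r * Q (M.+1 - r)%N = 1.
  elim: M => [|M IH]; first by rewrite big_nat1 subn0 /Q /series /= big_nat1.
  transitivity (\sum_(0 <= r < M.+1) c r * Q (M.+1 - r)%N +
                \sum_(0 <= r < M.+2) c r * q (M.+1 - r)%N).
    2: by rewrite IH cqS // addr0.
  rewrite [LHS]big_nat_recr //= [X in _ = _ + X]big_nat_recr //= addrA; congr (_ + _).
    rewrite -big_split /=; apply: eq_big_nat => r /andP[_ rM].
    by rewrite -mulrDr (subSn (ltnW _)) // /Q seriesSr addrC.
  by rewrite subSn // subnn /Q /series /= big_nat1.
rewrite -[RHS](conv (N + n)%N) [RHS](@big_cat_nat _ _ _ n.+1) //=; last by lia.
rewrite [X in _ = _ + X]big_nat_cond [X in _ = _ + X]big1 ?addr0 => [|r]; last first.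
  by move=> /andP[/andP[nr _] _]; rewrite c_supp ?mul0r.
apply: eq_big_nat => r /andP[_ rn]; congr (_ * Q _); lia.
Qed.

Lemma nondecreasing_partial_sums : nondecreasing_seq Q.
Proof.
by apply/nondecreasing_seqP => m; rewrite /Q seriesSr lerDl; have /andP[] := q01 m.
Qed.

(** In the relation between the partial sums, all shifts of [Q] have the same
    limit, which can be factored out. *)
Lemma bounded_renewal_sum B : (forall N, Q N <= B) ->
  exists2 l, (\sum_(0 <= m <oo) (q m)%:E = l%:E)%E & (\sum_(0 <= r < n.+1) c r) * l = 1.
Proof.
move=> QB.
have cvQ : cvgn Q.
  by apply: nondecreasing_is_cvgn; [exact: nondecreasing_partial_sums|exists B => _ [N _ <-]].
exists (limn Q).
  rewrite -EFin_lim //; congr (limn _); apply/funext => N /=.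
  by rewrite /Q /series /= sumEFin.
rewrite big_distrl /=.
have cvS : (fun N => \sum_(0 <= r < n.+1) c r * Q (N + (n.+1 - r))%N) @ \oo -->
   \sum_(0 <= r < n.+1) c r * limn Q.
  rewrite big_mkord.
  under eq_fun do rewrite big_mkord.
  apply: cvg_big => [|r _]; first exact: add_continuous.
  by apply: cvgMr; rewrite cvg_shiftn.
rewrite -(cvg_lim _ cvS) //.
under eq_fun do rewrite renewal_partial_sums.
by rewrite lim_cst.
Qed.

(** The value of the generating function of [q] at [1] is the inverse of that of
    [c], where [c] has finite support. Since [0 <= q <= 1], two partial sums of
    [q] differ by at most the number of terms between them. So the relation
    between the partial sums says that [S * Q N] is bounded. If [S] is nonzero,
    then [Q] is bounded and its limit is the inverse of [S]. If [S] is zero,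
    then [Q] cannot be bounded, as its limit times [0] would be [1]. *)
Lemma renewal_sum :
  (\sum_(0 <= m <oo) (q m)%:E = 1 / (\sum_(0 <= r < n.+1) c r)%:E)%E.
Proof.
set S := \sum_(0 <= r < n.+1) c r.
have [S0|S0] := eqVneq S 0; last first.
  (* n.+1 bounds all the shifts in the relation between the partial sums *)
  pose B := (1 + \sum_(0 <= r < n.+1) `|c r| * (n.+1)%:R) / `|S|.
  have [N|l -> Sl] := @bounded_renewal_sum B.
    rewrite /B ler_pdivlMr ?normr_gt0 //.
    have <- : `|Q N * S| = Q N * `|S|.
      rewrite normrM; congr (_ * _); apply: ger0_norm.
      by apply: sumr_ge0 => m _; have /andP[] := q01 m.
    have -> : Q N * S = 1 - \sum_(0 <= r < n.+1) c r * (Q (N + (n.+1 - r))%N - Q N).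
      rewrite -(renewal_partial_sums N) -sumrB mulrC /S big_distrl /=.
      by apply: eq_bigr => r _; rewrite mulrBr; ring.
    apply: le_trans (ler_normB _ _) _; rewrite normr1 lerD2l.
    apply: le_trans (ler_norm_sum _ _ _) _; apply: ler_sum_nat => r _.
    rewrite normrM ler_wpM2l //.
    have Qd j : 0 <= Q (N + j)%N - Q N <= j%:R.
      elim: j => [|j]; first by rewrite addn0 subrr lexx.
      by rewrite addnS /Q seriesSr -natr1; have := q01 (N + j)%N; lra.
    have /andP[Q0 Q1] := Qd (n.+1 - r)%N; rewrite ger0_norm //.
    by apply: le_trans Q1 _; rewrite ler_nat leq_subr.
  rewrite inver (negbTE S0) mul1e; congr EFin.
  by apply: (mulfI S0); rewrite Sl mulfV.
rewrite S0 inve0 mul1e; apply/eqP.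
have q0 m : (0 <= (q m)%:E)%E by rewrite lee_fin; have /andP[] := q01 m.
rewrite -leye_eq leNgt; apply/negP => fin.
have x0 : (0 <= \sum_(0 <= m <oo) (q m)%:E)%E by apply: nneseries_ge0.
have xfin : (\sum_(0 <= m <oo) (q m)%:E)%E \is a fin_num by rewrite ge0_fin_numE.
have [N|l _] := @bounded_renewal_sum (fine (\sum_(0 <= m <oo) (q m)%:E)%E).
  rewrite -lee_fin fineK // /Q /series /= -sumEFin.
  by apply: nneseries_lim_ge.
by rewrite -/S S0 mul0r => /eqP; rewrite eq_sym oner_eq0.
Qed.

End Renewal.

(** * Roots of unity filter *)

(** Both congruences as divisibilities of natural numbers; adding [k.-1] stands
    for subtracting [1], which also makes sense for [r = 0]. *)
Lemma psi_dvd k r : (2 <= k)%N ->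
  psi k r%:Z = (k %| r)%N%:Z - (k %| r + k.-1)%N%:Z.
Proof.
move=> k2; case: r => [|r].
  by rewrite psi0 dvdn0 add0n gtnNdvd ?subr0 //; lia.
by rewrite psiS // addSnnS prednK ?dvdn_addl //; lia.
Qed.

Lemma omegaX (R : realType) k r :
  omega R k ^+ r =
  Complex (cos (2 * pi / k%:R *+ r)) (sin (2 * pi / k%:R *+ r)).
Proof.
elim: r => [|r IH]; first by rewrite mulr0n cos0 sin0.
rewrite exprSr IH [2 * pi / k%:R *+ r.+1]mulrSr cosD sinD /omega; apply/eqP; rewrite eq_complex /=.
by apply/andP; split; apply/eqP; ring.
Qed.

(** [omega ^+ i.+1 = 1] would give [cos (2 x) = 1], that is [sin x = 0], at the
    angle [x = i.+1 * pi / k], which is strictly between [0] and [pi] when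
    [i.+1 < k]. *)
Lemma omega_primitive (R : realType) k : (0 < k)%N ->
  k.-primitive_root (omega R k).
Proof.
move=> k0; have k0R : k%:R != 0 :> R by rewrite pnatr_eq0 -lt0n.
apply/andP; split => //; apply/forallP => i; rewrite unity_rootE omegaX.
have [->|ik] := eqVneq i.+1 k.
  rewrite -mulr_natr mulfVK // mulr_natl cos2pi sin2pi.
  by rewrite eq_complex /= !eqxx.
pose x : R := pi / k%:R *+ i.+1.
have -> : 2 * pi / k%:R *+ i.+1 = x *+ 2.
  by rewrite /x -mulrA mulr_natl -!mulrnA mulnC.
have x0 : 0 < sin x.
  have ltik : (i.+1 < k)%N by rewrite ltn_neqAle ik ltn_ord.
  have kR : 0 < k%:R :> R by rewrite ltr0n.
  apply: sin_gt0_pi; rewrite /x -mulr_natr; apply/andP; split.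
    by rewrite !mulr_gt0 ?invr_gt0 ?pi_gt0.
  by rewrite mulrAC ltr_pdivrMr // ltr_pM2l ?pi_gt0 // ltr_nat.
rewrite eqbF_neg eq_complex /= cos_mulr2n cos2sin2 negb_and.
apply/orP; left; apply/eqP => h.
by have := exprn_gt0 2 x0; lra.
Qed.

Lemma sum_prim_root_exp (F : fieldType) k (z : F) r : k.-primitive_root z ->
  \sum_(0 <= s < k) (z ^+ r) ^+ s = (k * (k %| r))%N%:R.
Proof.
move=> zk; have k0 := prim_order_gt0 zk.
rewrite (prim_order_dvd zk); have [->|zr1] := eqVneq (z ^+ r) 1.
  under eq_bigr do rewrite expr1n.
  by rewrite sumr_const_nat subn0 muln1.
rewrite muln0; apply: (mulfI (x := z ^+ r - 1)); first by rewrite subr_eq0.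
by rewrite mulr0 big_mkord -subrX1 exprAC (prim_expr_order zk) expr1n subrr.
Qed.

(** Roots of unity filter: after expanding the [n]-th power, the sum over [s] of
    [z ^ (s r) - z ^ (s (r - 1))] is [k] times [psi k r]. The exponent [r - 1] is
    taken to be [r + k.-1], with the same power of [z]. *)
Lemma omega_sumE (R : realType) n k : (2 <= k)%N ->
  omega_sum R n k = real_complex R (k%:R * psi_sum R n k).
Proof.
move=> k2; have k0 : (0 < k)%N by lia.
have zk := omega_primitive R k0; set z := omega R k in zk.
have z0 : z != 0 by rewrite (prim_root_eq0 zk) -lt0n.
have zV : z^-1 = z ^+ k.-1.
  by apply: (mulfI z0); rewrite mulfV // -exprS prednK // (prim_expr_order zk).
(* the term for s = 0 vanishes, and completes the sum over all residues *)
have -> : omega_sum R n k =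
    \sum_(0 <= s < k) (1 - z ^- s) * (1 + z ^+ s / n%:R) ^+ n.
  rewrite [RHS]big_ltn // expr0 invr1 subrr mul0r add0r /omega_sum -/z.
  by [].
transitivity (\sum_(0 <= r < n.+1) ('C(n, r)%:R * n%:R ^- r) *
    (\sum_(0 <= s < k) (z ^+ r) ^+ s - \sum_(0 <= s < k) (z ^+ (r + k.-1)) ^+ s)).
  transitivity (\sum_(0 <= s < k) \sum_(0 <= r < n.+1) ('C(n, r)%:R * n%:R ^- r) *
    ((z ^+ r) ^+ s - (z ^+ (r + k.-1)) ^+ s)); last first.
    by rewrite exchange_big; apply: eq_bigr => r _; rewrite -sumrB big_distrr.
  apply: eq_bigr => s _; rewrite [1 + z ^+ s / _]addrC exprD1n big_distrr big_mkord /=.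
  apply: eq_bigr => r _; rewrite -mulr_natr expr_div_n exprD exprMn -zV exprVn.
  by rewrite -!exprM (mulnC s r); ring.
under eq_bigr do rewrite !sum_prim_root_exp //.
rewrite rmorphM /psi_sum rmorph_sum rmorph_nat big_distrr /=.
apply: eq_bigr => r _; rewrite psi_dvd // !rmorphM fmorphV rmorphXn !rmorph_nat.
rewrite rmorph_int intrB; ring.
Qed.

(** * Distribution of the first letters *)

(** Tail sum formula: a waiting time is the number of instants at which one is
    still waiting, also when it is infinite. *)
Lemma letters_drawn_series (R : realType) k (w : nat -> nat) :
  letters_drawn R k w =
  (\sum_(0 <= m <oo) (streak_free k w m)%:R%:E)%E.
Proof.
have u0 (m : nat) : (0 <= m)%N -> true -> (0 <= (streak_free k w m)%:R%:E :> \bar R)%E.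
  by rewrite lee_fin ler0n.
have [[m0 sm0]|none] := pselect (exists m, streak_at k w m); last first.
  have -> : letters_drawn R k w = +oo%E.
    rewrite /letters_drawn (_ : [set m%:R%:E | m in _] = set0) ?ereal_inf0 //.
    by rewrite -subset0 => _ [m /= sm _]; apply: none; exists m.
  apply/esym/eqyP => A A0; apply: le_trans (nneseries_lim_ge (Num.truncn A).+1 u0).
  rewrite sumEFin lee_fin (eq_bigr (fun=> 1)) => [|m _]; last first.
    by rewrite (_ : streak_free k w m) //; apply/streak_freeP => j _; apply/negP=> sj;
       apply: none; exists j.
  by rewrite big_const_nat iter_addr_0 subn0 ltW // truncnS_gt.
have exm : exists m, streak_at k w m by exists m0.
case: (ex_minnP exm) => M sM minM.
have freeE m : streak_free k w m = (m < M)%N.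
  apply/streak_freeP/idP => [h|mM j jm]; first by rewrite ltnNge; apply/negP => /h; rewrite sM.
  by apply/negP => /minM; lia.
rewrite (nneseries_split 0 M) // add0n [X in (_ + X)%E]eseries0 => [|m Mm _]; last first.
  by rewrite freeE ltnNge Mm.
rewrite adde0 sumEFin (eq_big_nat _ _ (F2 := fun=> 1)) => [|m /andP[_ mM]]; last first.
  by rewrite freeE mM.
rewrite big_const_nat iter_addr_0 subn0.
apply/eqP; rewrite eq_le; apply/andP; split; first by apply: ereal_inf_lbound; exists M.
by apply/ereal_infP => _ [m /= /minM Mm <-]; rewrite lee_fin ler_nat.
Qed.

Section RandomWord.
Context (R : realType) (d : measure_display) (T : measurableType d).
Context (P : probability T R) (X : nat -> {RV P >-> nat}).

Definition first_letters (m : nat) (t : T) : seq nat := mkseq (fun i => X i t) m.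

Definition cylinder (s : seq nat) : set T :=
  \bigcap_(i in [set` iota 0 (size s)]) (X i @^-1` [set nth 0%N s i]).

Lemma cylinderP s t : cylinder s t <-> first_letters (size s) t = s.
Proof.
split=> [h|<- i /=].
  apply: (@eq_from_nth _ 0%N); rewrite size_mkseq // => i ltis.
  by rewrite nth_mkseq //; apply: h; rewrite /= mem_iota.
by rewrite size_mkseq mem_iota => /andP[_ im]; rewrite nth_mkseq.
Qed.

Lemma measurable_cylinder s : measurable (cylinder s).
Proof.
apply: fin_bigcap_measurable => // i _.
by rewrite -[X in measurable X]setTI; apply: measurable_funPT.
Qed.

(** There are countably many finite words. *)
Lemma measurable_first_letters m (p : pred (seq nat)) :
  measurable [set t | p (first_letters m t)].
Proof.
rewrite (_ : [set t | _] =
    \bigcup_(s : seq nat) if p s && (size s == m) then cylinder s else set0).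
  apply: countable_bigcupT_measurable => // s.
  by case: ifP => _; [exact: measurable_cylinder|exact: measurable0].
apply/seteqP; split=> [t /= pt|t [s _]].
  exists (first_letters m t) => //; rewrite pt size_mkseq eqxx /=.
  by apply/cylinderP; rewrite size_mkseq.
by case: ifP => // /andP[ps /eqP <-] /cylinderP /= ->.
Qed.

Context (n : nat) (n1 : (1 <= n)%N) (indep : mutually_independent X).
Context (unif : forall i, uniform_letter n (X i)).

Lemma prob_cylinder (w : seq 'I_n) :
  P (cylinder (letters w)) = (n%:R ^- size w)%:E.
Proof.
rewrite /cylinder (indep (B := fun i => [set nth 0%N (letters w) i])) ?iota_uniq //.
rewrite (eq_big_seq (fun=> (n%:R^-1)%:E)) => [|i]; last first.
  rewrite mem_iota size_map => /andP[_ iw]; apply: unif.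
  by case: w iw => // a w iw; rewrite (nth_map a) // /= ltn_ord.
rewrite -(big_morph EFin (@EFinM R) erefl) big_const_seq count_predT size_iota size_map.
by rewrite iter_mulr_1 exprVn.
Qed.

(** The event contains the disjoint cylinders of the words with letters from
    [1] to [n] that satisfy [p], all of probability [n ^- m]. *)
Lemma prob_first_letters_ge m (p : pred (seq nat)) :
  (((count_words n m p)%:R / n%:R ^+ m)%:E <= P [set t | p (first_letters m t)])%E.
Proof.
pose A := [set w : m.-tuple 'I_n | p (letters w)]%SET.
pose D := [set` enum A].
pose C (w : m.-tuple 'I_n) := cylinder (letters w).
have finD : finite_set D by exact: finite_seq.
have mC w : D w -> measurable (C w) by move=> _; exact: measurable_cylinder.
have szl (w : m.-tuple 'I_n) : size (letters w) = m by rewrite size_map size_tuple.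
have tC : trivIset D C.
  move=> u v _ _ [t [/cylinderP]]; rewrite szl => tu /cylinderP; rewrite szl tu.
  by move/inj_map => /(_ _) /val_inj -> // a b [] /val_inj.
have -> : ((count_words n m p)%:R / n%:R ^+ m)%:E = P (\bigcup_(w in D) C w).
  rewrite measure_fin_bigcup // -fsbig_seq ?enum_uniq //.
  rewrite (eq_bigr (fun=> (n%:R ^- m)%:E)) => [|w _]; last first.
    by rewrite -[in RHS](size_tuple w); exact: prob_cylinder.
  by rewrite sumEFin big_const_seq count_predT iter_addr_0 -cardE mulr_natl.
apply: le_measure; rewrite ?inE.
- exact: fin_bigcup_measurable.
- exact: measurable_first_letters.
- move=> t [w]; rewrite /D /= mem_enum inE => pw /cylinderP.
  by rewrite szl => ->.
Qed.

(** The lower bounds for [p] and for its complement add up to [1], so both are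
    attained. This also covers the null set on which some letter lies outside of
    [1, ..., n]. *)
Lemma prob_first_letters m (p : pred (seq nat)) :
  P [set t | p (first_letters m t)] = ((count_words n m p)%:R / n%:R ^+ m)%:E.
Proof.
have := prob_first_letters_ge m p; have := prob_first_letters_ge m (predC p).
rewrite (_ : [set t | predC p _] = ~` [set t | p (first_letters m t)]); last first.
  by apply/seteqP; split => t /= /negP.
rewrite probability_setC; last exact: measurable_first_letters.
have := fin_num_measure P _ (measurable_first_letters m p).
move=> /fineK <-; set x := fine _; rewrite -EFinB !lee_fin => h1 h2.
congr EFin; apply/eqP; rewrite eq_le h2 andbT.
have e : (count_words n m (predC p))%:R + (count_words n m p)%:R = n%:R ^+ m :> R.
  rewrite -natrD -natrX addnC -[in RHS](card_ord n) -card_tuple.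
  rewrite -(cardsC [set w : m.-tuple 'I_n | p (letters w)]%SET).
  by congr (_ + _)%:R; apply: eq_card => w; rewrite !inE.
have n0 : n%:R ^+ m != 0 :> R by rewrite expf_neq0 // pnatr_eq0 -lt0n.
have : (count_words n m (predC p))%:R / n%:R ^+ m +
       (count_words n m p)%:R / n%:R ^+ m = 1 :> R by rewrite -mulrDl e divff.
lra.
Qed.
End RandomWord.

(** * The expected number of letters *)

Section Expectation.
Context (R : realType) (d : measure_display) (T : measurableType d).
Context (P : probability T R) (X : nat -> {RV P >-> nat}) (n k : nat).
Context (n1 : (1 <= n)%N) (indep : mutually_independent X).
Context (unif : forall i, uniform_letter n (X i)).

Lemma expected_letters_series :
  expected_letters k X =
  (\sum_(0 <= m <oo) ((free_words n k m)%:R / n%:R ^+ m)%:E)%E.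
Proof.
rewrite /expected_letters.
pose A m := [set t | streak_free k (fun i => X i t) m].
have AE m : A m = [set t | streak_free k (nth 0%N (first_letters X m t)) m].
  rewrite /A; congr mkset; apply/funext => t; congr is_true.
  by apply: streak_free_ext => i im; rewrite nth_mkseq.
have mA m : measurable (A m).
  by rewrite AE; apply: (measurable_first_letters _ _ (fun s => streak_free k (nth 0%N s) m)).
under eq_integral do rewrite letters_drawn_series.
transitivity (\int[P]_t (\sum_(0 <= m <oo) (\1_(A m) t)%:E))%E.
  apply: eq_integral => t _; apply: eq_eseriesr => m _.
  rewrite indicE; case: (boolP (streak_free _ _ _)) => free; first by rewrite mem_set.
  by rewrite memNset //; exact/negP.
rewrite integral_nneseries // => [|m]; last first.
  by apply/measurable_realfun.measurable_EFinP; exact: measurable_realfun.measurable_indic.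
apply: eq_eseriesr => m _; rewrite integral_indic // setIT AE.
exact: (prob_first_letters n1 indep unif m (fun s => streak_free k (nth 0%N s) m)).
Qed.

Lemma expected_letters_psi : (2 <= k)%N ->
  expected_letters k X = (1 / (psi_sum R n k)%:E)%E.
Proof.
move=> k2; rewrite expected_letters_series /psi_sum.
apply: (@renewal_sum R n (fun r => (psi k r%:Z)%:~R * 'C(n, r)%:R * n%:R ^- r)
  (fun m => (free_words n k m)%:R / n%:R ^+ m)).
- move=> m; rewrite divr_ge0 ?exprn_ge0 //= ler_pdivrMr ?mul1r; last first.
    by rewrite exprn_gt0 // ltr0n.
  rewrite -natrX ler_nat -[X in (X ^ m)%N](card_ord n) -card_tuple.
  exact: max_card.
- by move=> r nr; rewrite bin_small // mulr0 mul0r.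
- rewrite psi0 bin0 !expr0 !mul1r invr1 mul1r mulr1.
  rewrite /free_words (@eq_count_words _ _ _ xpredT) ?count_wordsT // => s _.
  by apply/streak_freeP => j; rewrite leqn0 => /eqP ->; rewrite streak_atE leqNgt; lia.
- move=> m m0.
  transitivity (n%:R ^- m * (\sum_(0 <= r < m.+1)
     psi k r%:Z * ('C(n, r) * free_words n k (m - r))%N%:Z)%:~R : R).
    rewrite rmorph_sum big_distrr; apply: eq_big_nat => r /andP[_ rm] /=.
    have -> : n%:R ^- m = n%:R ^- r * n%:R ^- (m - r) :> R.
      by rewrite -invfM -exprD subnKC.
    by rewrite intrM PoszM intrM; ring.
  by rewrite free_words_recurrence // mulr0.
Qed.
End Expectation.

(* Division is in [\bar R], where [0^-1 = +oo]; this is the case [n < k], in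
   which no streak can occur and both denominators vanish. The complex
   denominator is asserted to be real before it is compared with [E(n, k)]. *)
Theorem theorem5p1 (R : realType) (n k : nat) (hn : (1 <= n)%N) (hk : (2 <= k)%N)
    (d : measure_display) (T : measurableType d) (P : probability T R)
    (X : nat -> {RV P >-> nat})
    (X_indep : mutually_independent X)
    (X_unif : forall i : nat, uniform_letter n (X i)) :
  expected_letters k X = (1 / (psi_sum R n k)%:E)%E /\
  complex.Im (omega_sum R n k) = 0 /\
  expected_letters k X = (k%:R%:E / (complex.Re (omega_sum R n k))%:E)%E.
Proof.
have E1 := expected_letters_psi hn X_indep X_unif hk.
split=> //; rewrite omega_sumE //; split=> //; rewrite E1 /=.
have k0 : k%:R != 0 :> R by rewrite pnatr_eq0; lia.
rewrite mul1e !inver mulf_eq0 (negbTE k0) /=; case: ifP => S0.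
  by rewrite gt0_muley // lte_fin ltr0n; lia.
by rewrite -EFinM invfM mulrA divff // mul1r.
Qed.
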